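(* Let $F=\frac1n\sum_{i=1}^n f_i:\mathbb{R}^d\to\mathbb{R}$, where $F$ is bounded below and attains its global minimum at $x^*$, each $f_i$ has $L_1$-Lipschitz continuous gradient, and each $f_i$ has $L_2$-Lipschitz continuous Hessian. Let $x^0\in\mathbb{R}^d$, $\Delta=F(x^0)-F(x^* )$ and $\epsilon>0$. Run the Inexact Trust Region Method (described in the context) from $x^0$ with trust-region radius $r=\sqrt{\epsilon/L_2}$, and suppose that for all $k$ the gradient estimator $g^k$ and the Hessian estimator $H^k$ satisfy $$\|g^k-\nabla F(x^k)\|\le \frac{\epsilon}{6},\qquad \|H^k-\nabla^2F(x^k)\|\le\frac{\sqrt{\epsilon L_2}}{3}.$$ Then the method finds an $\mathcal{O}(\epsilon,\sqrt{\epsilon})$-SOSP in less than $K=\mathcal{O}(\sqrt{L_2}\,\Delta/\epsilon^{1.5})$ iterations; that is, within that many iterations its stopping test is met and its output $x_\epsilon$ satisfies $\|\nabla F(x_\epsilon)\|\le C\epsilon$ and $\nabla^2F(x_\epsilon)\succcurlyeq -C\sqrt{L_2\epsilon}\,I$ for an absolute constant $C$.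
   Context: $\|\cdot\|$ is the Euclidean norm for vectors and the spectral norm for matrices. ''$L_1$-Lipschitz gradient'' means $\|\nabla f_i(x)-\nabla f_i(y)\|\le L_1\|x-y\|$, and ''$L_2$-Lipschitz Hessian'' means $\|\nabla^2 f_i(x)-\nabla^2 f_i(y)\|\le L_2\|x-y\|$, for all $x,y\in\mathbb{R}^d$. An $\epsilon$-SOSP (i.e. $(\epsilon,\sqrt\epsilon)$-approximate second-order stationary point) is a point $x$ with $\|\nabla F(x)\|\le\epsilon$ and $\nabla^2F(x)\succcurlyeq-\sqrt{L_2\epsilon}\,I$. Inexact Trust Region Method. For $k=0,1,2,\dots$: given a vector $g^k\in\mathbb{R}^d$ and a symmetric matrix $H^k\in\mathbb{R}^{d\times d}$, compute a global minimizer $$h^k\in\arg\min_{\|h\|\le r}\ \langle g^k,h\rangle+\tfrac12\langle H^kh,h\rangle$$ together with its dual variable $\lambda^k\ge0$, normalized so that $$g^k+H^kh^k+\tfrac{L_2\lambda^k}{2}h^k=0,\qquad H^k+\tfrac{L_2\lambda^k}{2}I\succcurlyeq0,\qquad \lambda^k(\|h^k\|-r)=0;$$ set $x^{k+1}=x^k+h^k$; if $\lambda^k\le 2\sqrt{\epsilon/L_2}$, stop and output $x_\epsilon=x^{k+1}$. $\mathcal{O}(\cdot)$ hides absolute constants only; an iteration bound $\mathcal{O}(Q)$ is understood as at most $C\max\{1,Q\}$ for an absolute constant $C$, since at least one iteration is always performed. *)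

(* Defs.v *)
From HB Require Import structures.
From mathcomp Require Import all_boot all_order all_algebra.
From mathcomp Require Import all_classical all_reals all_analysis.

Set Implicit Arguments.
Unset Strict Implicit.
Unset Printing Implicit Defensive.

Import Order.TTheory GRing.Theory Num.Theory.
Import numFieldNormedType.Exports.

Local Open Scope classical_set_scope.
Local Open Scope ring_scope.

(* Vectors of R^d are row vectors, as for the library's Jacobian: a matrix A
   acts by v |-> v *m A.  For the symmetric matrices of the algorithm this is
   the usual A v; transposing changes neither the spectral norm nor the
   quadratic form of A. *)

Definition dot (R : realType) (d : nat) (u v : 'rV[R]_d) : R :=
  \sum_(i < d) u 0 i * v 0 i.

(* The library norm `|v| on 'rV[R]_d is the sup norm, hence this definition. *)
Definition enorm (R : realType) (d : nat) (v : 'rV[R]_d) : R :=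
  Num.sqrt (dot v v).

Definition specnorm (R : realType) (d : nat) (A : 'M[R]_d) : R :=
  sup [set enorm (v *m A) | v in [set v : 'rV[R]_d | enorm v <= 1]].

(* B - A is positive semidefinite, as a comparison of quadratic forms; used
   only for matrices that are symmetric (by assumption, or as Hessians of C^2
   functions). *)
Definition loewner_le (R : realType) (d : nat) (A B : 'M[R]_d) : Prop :=
  forall v : 'rV[R]_d, dot (v *m A) v <= dot (v *m B) v.

Definition grad (R : realType) (d : nat) (f : 'rV[R]_d -> R) (x : 'rV[R]_d) :
    'rV[R]_d :=
  \row_(i < d) 'D_(delta_mx 0 i) f x.

Definition hess (R : realType) (d : nat) (f : 'rV[R]_d -> R) (x : 'rV[R]_d) :
    'M[R]_d :=
  jacobian (grad f) x.

(* 'D and jacobian are total, so differentiability is required explicitly. *)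
Definition lipschitz_grad (R : realType) (d : nat) (L : R)
    (f : 'rV[R]_d -> R) : Prop :=
  (forall x, differentiable f x) /\
  (forall x y, enorm (grad f x - grad f y) <= L * enorm (x - y)).

Definition lipschitz_hess (R : realType) (d : nat) (L : R)
    (f : 'rV[R]_d -> R) : Prop :=
  [/\ forall x, differentiable f x,
      forall x, differentiable (grad f) x &
      forall x y, specnorm (hess f x - hess f y) <= L * enorm (x - y)].

Definition average (R : realType) (d n : nat) (f : 'I_n -> 'rV[R]_d -> R)
    (x : 'rV[R]_d) : R :=
  n%:R^-1 * \sum_(i < n) f i x.

Definition approx_sosp (R : realType) (d : nat) (F : 'rV[R]_d -> R)
    (eps_g eps_H : R) (x : 'rV[R]_d) : Prop :=
  enorm (grad F x) <= eps_g /\ loewner_le (- eps_H)%:M (hess F x).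

Definition tr_model (R : realType) (d : nat) (g : 'rV[R]_d) (H : 'M[R]_d)
    (h : 'rV[R]_d) : R :=
  dot g h + 2^-1 * dot (h *m H) h.

Record tr_solution (R : realType) (d : nat) (L2 r : R) (g : 'rV[R]_d)
    (H : 'M[R]_d) (h : 'rV[R]_d) (lam : R) : Prop := TrSolution {
  tr_feasible : enorm h <= r ;
  tr_minimal : forall h' : 'rV[R]_d, enorm h' <= r ->
    tr_model g H h <= tr_model g H h' ;
  tr_dual_ge0 : 0 <= lam ;
  tr_stationary : g + h *m H + (L2 * lam / 2) *: h = 0 ;
  tr_psd : loewner_le 0 (H + (L2 * lam / 2)%:M) ;
  tr_slackness : lam * (enorm h - r) = 0
}.

Definition tr_stop (R : realType) (L2 eps : R) (lam : nat -> R) (k : nat) :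
    Prop :=
  lam k <= 2 * Num.sqrt (eps / L2).

(* Iteration k takes place iff the stopping test failed at all earlier ones. *)
Definition tr_executed (R : realType) (L2 eps : R) (lam : nat -> R) (k : nat) :
    Prop :=
  forall j, (j < k)%N -> ~ tr_stop L2 eps lam j.

(* A run is encoded by total sequences; only the terms of executed iterations
   (and the final iterate) are constrained. *)
Record tr_run (R : realType) (d : nat) (L2 eps r : R) (x0 : 'rV[R]_d)
    (x g : nat -> 'rV[R]_d) (H : nat -> 'M[R]_d) (h : nat -> 'rV[R]_d)
    (lam : nat -> R) : Prop := TrRun {
  run_init : x 0%N = x0 ;
  run_sym : forall k, tr_executed L2 eps lam k -> (H k)^T = H k ;
  run_solution : forall k, tr_executed L2 eps lam k ->
    tr_solution L2 r (g k) (H k) (h k) (lam k) ;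
  run_update : forall k, tr_executed L2 eps lam k -> x k.+1 = x k + h k
}.

(* Main.v *)
Require Import Defs.
From HB Require Import structures.
From mathcomp Require Import all_boot all_order all_algebra.
From mathcomp Require Import all_classical all_reals all_analysis.
From mathcomp Require Import ring lra.

Set Implicit Arguments.
Unset Strict Implicit.
Unset Printing Implicit Defensive.

Import Order.TTheory GRing.Theory Num.Theory.
Import numFieldNormedType.Exports.

Local Open Scope ring_scope.

(** Put r = sqrt (eps / L2), so that eps = L2 r^2 and sqrt (eps L2) = L2 r: all
    errors are then multiples of L2 r^3 for function values, of L2 r^2 for
    gradients and of L2 r for Hessians.  Call a step long when lam > 2 r, that
    is, when the stopping test fails; a long step has length exactly r.

    The textbook estimate does not suffice here.  It bounds the decrease
    F x - F (x + h) of a long step from below by L2 r^2 (lam - 2 r) / 4: the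
    gain L2 r^3 / 2 of the model is entirely consumed by the gradient error,
    the Hessian error and the cubic remainder, which contribute L2 r^3 / 6
    each.  A single long step may indeed gain arbitrarily little.

    Two consecutive long steps cannot both be this bad.  If a long step from x
    gains almost nothing, the bounds used above are almost attained at x + h:
    the upper cubic model of F at x nearly touches F there.  Then the two
    functions have nearly the same gradient, and that of the model turns out to
    be nearly zero; hence so is the gradient of F at x + h.  But the next long
    step, h' from x + h, can only be bad if the gradient there points along h',
    with norm about L2 r^2 / 6, so that the estimator may miss it.
    Quantitatively:
    - [next_grad_le] compares, at x + h + s, the upper cubic bound based at x
      with the lower one based at x + h.  This bounds the slope of F at x + h
      in any direction s by the decrease of the step plus terms that
      for long steps are quadratic in s ([long_step_next_grad]);
    - [decrease_vs_grad] bounds the decrease of a long step from below by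
      L2 r^3 / 12 minus half the slope of F along the step;
    - taking s = h' / 20, the decreases of two consecutive long steps add up to
      at least L2 r^3 / 300 ([two_long_steps_decrease]).
    Hence at most about 600 Delta / (L2 r^3) steps are long, and
    L2 r^3 = eps^(3/2) / sqrt L2.

    At a short step, [next_grad_le] with s a multiple of the gradient at x + h
    bounds that gradient by 5 eps, and the dual certificate, the Hessian error
    and the Lipschitz bound give the lower bound on the Hessian.

    The only second-order facts about F that enter are the cubic Taylor bound,
    obtained by differentiating twice along a segment, and the Lipschitz
    continuity of the quadratic form of the Hessian. *)

(** * Euclidean and spectral norms *)

Section Euclid.
Context {R : realType} {d : nat}.
Implicit Types (u v w : 'rV[R]_d) (A B : 'M[R]_d).

Lemma dotE u v : dot u v = (u *m v^T) 0 0.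
Proof. by rewrite mxE; apply: eq_bigr => i _; rewrite mxE. Qed.

Lemma dotC u v : dot u v = dot v u.
Proof. by apply: eq_bigr => i _; rewrite mulrC. Qed.

Lemma dotDl u v w : dot (u + v) w = dot u w + dot v w.
Proof. by rewrite !dotE mulmxDl mxE. Qed.

Lemma dotDr u v w : dot u (v + w) = dot u v + dot u w.
Proof. by rewrite dotC dotDl !(dotC u). Qed.

Lemma dotZl a u v : dot (a *: u) v = a * dot u v.
Proof. by rewrite !dotE -scalemxAl mxE. Qed.

Lemma dotZr a u v : dot u (a *: v) = a * dot u v.
Proof. by rewrite dotC dotZl dotC. Qed.

Lemma dotBl u v w : dot (u - v) w = dot u w - dot v w.
Proof. by rewrite dotDl -scaleN1r dotZl mulN1r. Qed.

Lemma dot0l u : dot 0 u = 0.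
Proof. by rewrite dotE mul0mx mxE. Qed.

Lemma dot_mulmx A u v : dot (u *m A) v = dot u (v *m A^T).
Proof. by rewrite !dotE trmx_mul trmxK mulmxA. Qed.

Lemma dot_ge0 u : 0 <= dot u u.
Proof. by apply: sumr_ge0 => i _; rewrite -expr2 sqr_ge0. Qed.

Lemma enorm_ge0 u : 0 <= enorm u.
Proof. exact: sqrtr_ge0. Qed.

Lemma sqr_enorm u : enorm u ^+ 2 = dot u u.
Proof. by rewrite sqr_sqrtr ?dot_ge0. Qed.

Lemma enorm_eq0 u : enorm u = 0 -> u = 0.
Proof.
move=> u0; have : dot u u = 0 by rewrite -sqr_enorm u0 expr0n.
move/psumr_eq0P => /= H; apply/rowP => i; rewrite mxE.
have /(_ i isT)/eqP := H (fun i _ => sqr_ge0 (u 0 i)).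
by rewrite mulf_eq0 orbb => /eqP.
Qed.

Lemma enorm0 : enorm (0 : 'rV[R]_d) = 0.
Proof. by rewrite /enorm dot0l sqrtr0. Qed.

Lemma enormZ a u : enorm (a *: u) = `|a| * enorm u.
Proof.
by rewrite /enorm dotZl dotZr mulrA -expr2 sqrtrM ?sqr_ge0// sqrtr_sqr.
Qed.

Lemma cauchy_schwarz u v : `|dot u v| <= enorm u * enorm v.
Proof.
have [v0|v0] := eqVneq (enorm v) 0.
  by rewrite (enorm_eq0 v0) dotC dot0l normr0 enorm0 mulr0.
have vv : 0 < dot v v by rewrite -sqr_enorm exprn_gt0// lt_def v0 enorm_ge0.
rewrite -ler_sqr ?nnegrE ?mulr_ge0 ?enorm_ge0// real_normK ?num_real//.
rewrite exprMn !sqr_enorm.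
(* v.v times the residual of projecting u on v, which avoids a division *)
have := dot_ge0 (dot v v *: u - dot u v *: v).
rewrite dotBl ![dot _ (_ - _)]dotC !dotBl !dotZl !(dotC _ (_ *: _)) !dotZl.
rewrite (dotC v u) => H.
have : 0 <= dot v v * (dot u u * dot v v - dot u v ^+ 2) by nra.
by rewrite pmulr_rge0// subr_ge0.
Qed.

Lemma dot_le u v : dot u v <= enorm u * enorm v.
Proof. exact: le_trans (ler_norm _) (cauchy_schwarz u v). Qed.

Lemma enormD u v : enorm (u + v) <= enorm u + enorm v.
Proof.
rewrite -ler_sqr ?nnegrE ?addr_ge0 ?enorm_ge0// sqrrD !sqr_enorm.
rewrite dotDl !dotDr (dotC v u); have := dot_le u v; lra.
Qed.

(** A supremum over an unbounded set is a default value: this bound is what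
    makes [specnorm] the operator norm. *)
Lemma enorm_mulmx_bounded A :
  exists M, forall v, enorm v <= 1 -> enorm (v *m A) <= M.
Proof.
exists (Num.sqrt (\sum_(j < d) dot (col j A)^T (col j A)^T)) => v v1.
rewrite ler_wsqrtr//; apply: ler_sum => j _.
have -> : (v *m A) 0 j = dot v (col j A)^T.
  by rewrite mxE; apply: eq_bigr => i _; rewrite !mxE.
rewrite -expr2 -real_normK ?num_real// -[leRHS]sqr_enorm.
rewrite ler_sqr ?nnegrE ?enorm_ge0 ?normr_ge0//.
by apply: le_trans (cauchy_schwarz _ _) _; rewrite ler_piMl ?enorm_ge0.
Qed.

Lemma enorm_mulmx_le A v : enorm (v *m A) <= specnorm A * enorm v.
Proof.
have [v0|v0] := eqVneq (enorm v) 0.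
  by rewrite (enorm_eq0 v0) mul0mx enorm0 mulr0.
have vgt0 : 0 < enorm v by rewrite lt_def v0 enorm_ge0.
rewrite -ler_pdivrMr// mulrC.
have -> : (enorm v)^-1 * enorm (v *m A) = enorm ((enorm v)^-1 *: v *m A).
  by rewrite -scalemxAl enormZ ger0_norm// invr_ge0 enorm_ge0.
apply: ub_le_sup.
  have [M AM] := enorm_mulmx_bounded A.
  by exists M => _ [u /= u1 <-]; exact: AM.
exists ((enorm v)^-1 *: v) => //=.
by rewrite enormZ ger0_norm ?invr_ge0 ?enorm_ge0// mulVf.
Qed.

Lemma specnorm_le A c : 0 <= c ->
  (forall v, enorm (v *m A) <= c * enorm v) -> specnorm A <= c.
Proof.
move=> c0 Ac; apply: ge_sup.
  by exists (enorm (0 *m A)), 0 => //=; rewrite enorm0.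
by move=> _ [v /= v1 <-]; apply: le_trans (Ac v) _; rewrite ler_piMr.
Qed.

Lemma quad_specnorm_le A B c v : specnorm (A - B) <= c ->
  `|dot (v *m A) v - dot (v *m B) v| <= c * enorm v ^+ 2.
Proof.
move=> ABc; rewrite -dotBl -mulmxBr; apply: le_trans (cauchy_schwarz _ _) _.
rewrite expr2 mulrA ler_wpM2r ?enorm_ge0//.
apply: le_trans (enorm_mulmx_le _ _) _.
by rewrite ler_wpM2r ?enorm_ge0.
Qed.

Lemma quad_sym A u v : A^T = A -> dot ((u + v) *m A) (u + v) =
  dot (u *m A) u + 2 * dot (u *m A) v + dot (v *m A) v.
Proof.
move=> At; rewrite mulmxDl !dotDl !dotDr [dot (v *m A) u]dot_mulmx At.
by rewrite [dot v _]dotC; ring.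
Qed.

End Euclid.

(** * The cubic Taylor bound *)

Section Taylor.
Context {R : realType}.

Lemma le0_is_derive (f df : R -> R) : (forall t : R, is_derive t 1 f (df t)) ->
  (forall t, 0 <= t -> df t <= 0) -> forall t, 0 <= t -> f t <= f 0.
Proof.
move=> fdf df0 t t0; rewrite -subr_le0.
have [|c + ->] := @MVT_segment R f df 0 t t0 (fun x _ => fdf x).
  by apply: derivable_within_continuous => x _; apply: ex_derive.
by rewrite in_itv/= subr0 => /andP[c0 _]; rewrite mulr_le0_ge0// df0.
Qed.

(** Subtracting the cubic model from f leaves a function whose second, then
    first derivative, hence value, is nonpositive on the right of 0. *)
Lemma taylor_cubic_le (f f1 f2 : R -> R) (c : R) :
  (forall t : R, is_derive t 1 f (f1 t)) ->
  (forall t : R, is_derive t 1 f1 (f2 t)) ->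
  (forall t, 0 <= t -> f2 t - f2 0 <= c * t) ->
  f 1 - f 0 - f1 0 - f2 0 / 2 <= c / 6.
Proof.
move=> df df1 f2c.
have H1 t : 0 <= t -> f1 t - f2 0 * t - c / 2 * t ^+ 2 <= f1 0.
  pose g (t : R) := f1 t - f2 0 * t - c / 2 * t ^+ 2.
  move=> t0; have -> : f1 0 = g 0 by rewrite /g; ring.
  apply: (@le0_is_derive g (fun t => f2 t - f2 0 - c * t)) t t0 => [t|t t0].
    have D1 := df1 t.
    have Dt := is_derive_id t (1 : R).
    apply: (is_derive_eq (is_deriveB (is_deriveB D1 (is_deriveZ (f2 0) Dt))
      (is_deriveZ (c / 2) (is_deriveX 2 Dt)))).
    by rewrite /GRing.scale/=; field.
  by have := f2c t t0; lra.
pose g (t : R) := f t - f1 0 * t - f2 0 / 2 * t ^+ 2 - c / 6 * t ^+ 3.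
have : g 1 <= g 0.
  pose dg t := f1 t - f2 0 * t - c / 2 * t ^+ 2 - f1 0.
  apply: (@le0_is_derive g dg) => // [t|t t0]; rewrite /dg.
    have D1 := df t.
    have Dt := is_derive_id t (1 : R).
    apply: (is_derive_eq (is_deriveB (is_deriveB (is_deriveB D1
      (is_deriveZ (f1 0) Dt)) (is_deriveZ (f2 0 / 2) (is_deriveX 2 Dt)))
      (is_deriveZ (c / 6) (is_deriveX 3 Dt)))).
    by rewrite /GRing.scale/=; field.
  by have := H1 t t0; lra.
by rewrite /g; lra.
Qed.

Lemma taylor_cubic (f f1 f2 : R -> R) (c : R) :
  (forall t : R, is_derive t 1 f (f1 t)) ->
  (forall t : R, is_derive t 1 f1 (f2 t)) ->
  (forall t, 0 <= t -> `|f2 t - f2 0| <= c * t) ->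
  `|f 1 - f 0 - f1 0 - f2 0 / 2| <= c / 6.
Proof.
move=> df df1 f2c; rewrite ler_norml; apply/andP; split; last first.
  by apply: (taylor_cubic_le df df1) => t /f2c; rewrite ler_norml => /andP[].
have := @taylor_cubic_le (- f) (- f1) (- f2) c (fun t => is_deriveN (df t))
  (fun t => is_deriveN (df1 t)).
rewrite !opprfctE => H.
suff : - f 1 - - f 0 - - f1 0 - - f2 0 / 2 <= c / 6 by lra.
by apply: H => t /f2c; rewrite ler_norml => /andP[]; lra.
Qed.

Context {d : nat}.
Implicit Types (x h : 'rV[R]_d).

Lemma derive_dot_grad (f : 'rV[R]_d -> R) x h : differentiable f x ->
  'D_h f x = dot (grad f x) h.
Proof.
move=> df; rewrite deriveE// {1}(row_sum_delta h) linear_sum.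
by apply: eq_bigr => i _; rewrite linearZ /= mxE deriveE// mulrC.
Qed.

(** The difference quotient of f along the segment at time t is literally its
    directional difference quotient at the point x + t h. *)
Lemma is_derive_line (V : normedModType R) (f : 'rV[R]_d -> V) x h (t : R) :
  derivable f (x + t *: h) h ->
  is_derive t 1 (fun t => f (x + t *: h)) ('D_h f (x + t *: h)).
Proof.
have E : (fun s : R => s^-1 *: (f (x + (s *: 1 + t) *: h) - f (x + t *: h))) =
         (fun s : R => s^-1 *: (f (s *: h + (x + t *: h)) - f (x + t *: h))).
  by apply/funext => s; rewrite [s *: 1]mulr1 scalerDl addrCA.
move=> df; split; first by rewrite /derivable E.
by rewrite /derive E.
Qed.

Lemma is_derive_dot (f : R -> 'rV[R]_d) h (t : R) df : is_derive t 1 f df ->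
  is_derive t 1 (fun t => dot (f t) h) (dot df h).
Proof.
move=> [fd <-]; rewrite (derive_mx fd).
have fdi i := (derivable_mxP _ _ _).1 fd 0 i.
have D := is_derive_sum
  (fun i : 'I_d => is_deriveZ (h 0 i) (derivableP (fdi i))).
have E : (fun t => dot (f t) h) = \sum_(i < d) (h 0 i \*: fun t => f t 0 i).
  by apply/funext => s; rewrite fct_sumE; apply: eq_bigr => i _; rewrite mulrC.
rewrite E; apply: (is_derive_eq D).
by apply: eq_bigr => i _; rewrite mxE mulrC.
Qed.

(** [taylor_cubic] for t |-> f (x + t h): the quadratic form of the Hessian,
    evaluated at h, moves by at most L t |h|^3. *)
Lemma taylor_lipschitz_hess (f : 'rV[R]_d -> R) L x h : lipschitz_hess L f ->
  `|f (x + h) - f x - dot (grad f x) h - dot (h *m hess f x) h / 2| <=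
  L / 6 * enorm h ^+ 3.
Proof.
move=> [df dg Lh].
have := @taylor_cubic (fun t => f (x + t *: h))
  (fun t => dot (grad f (x + t *: h)) h)
  (fun t => dot (h *m hess f (x + t *: h)) h) (L * enorm h ^+ 3).
rewrite scale1r scale0r addr0 [L / 6 * _]mulrAC; apply.
- move=> t; rewrite -derive_dot_grad//; apply: is_derive_line.
  exact: diff_derivable.
- move=> t; rewrite -deriveEjacobian//; apply/is_derive_dot/is_derive_line.
  exact: diff_derivable.
- move=> t t0; apply: le_trans (quad_specnorm_le h (Lh _ _)) _.
  rewrite addrC addKr enormZ ger0_norm//.
  by rewrite le_eqVlt; apply/orP; left; apply/eqP; ring.
Qed.
End Taylor.

(** * Averages of functions with Lipschitz Hessian *)

Section Average.
Context {R : realType} {d : nat}.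

Lemma averageE n (f : 'I_n -> 'rV[R]_d -> R) :
  average f = n%:R^-1 \*: \sum_(i < n) f i.
Proof. by apply/funext => x; rewrite /average/= fct_sumE. Qed.

Lemma grad_average n (f : 'I_n -> 'rV[R]_d -> R) :
  (forall i x, differentiable (f i) x) ->
  grad (average f) = n%:R^-1 \*: \sum_(i < n) grad (f i).
Proof.
move=> df; apply/funext => x; apply/rowP => j.
rewrite mxE averageE deriveZ; last first.
  by apply: derivable_sum => i; exact: diff_derivable.
rewrite derive_sum => [|i]; last exact: diff_derivable.
rewrite /= fct_sumE mxE summxE; congr (_ * _).
by apply: eq_bigr => i _; rewrite mxE.
Qed.

Lemma hess_average n (f : 'I_n -> 'rV[R]_d -> R) x :
  (forall i y, differentiable (f i) y) ->
  (forall i, differentiable (grad (f i)) x) ->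
  hess (average f) x = n%:R^-1 *: \sum_(i < n) hess (f i) x.
Proof.
move=> df dg; apply/row_matrixP => j; rewrite !rowE.
rewrite /hess grad_average// -deriveEjacobian; last first.
  by apply: differentiableZ; exact: differentiable_sum.
rewrite deriveZ; last by apply/diff_derivable/differentiable_sum.
rewrite derive_sum => [|i]; last exact: diff_derivable.
rewrite -scalemxAr mulmx_sumr; congr (_ *: _).
by apply: eq_bigr => i _; rewrite deriveEjacobian.
Qed.

Lemma enorm_sum n (v : 'I_n -> 'rV[R]_d) (c : R) :
  (forall i, enorm (v i) <= c) -> enorm (\sum_(i < n) v i) <= n%:R * c.
Proof.
move=> vc; have : enorm (\sum_(i < n) v i) <= \sum_(i < n) c.
  elim/big_ind2 : _ => //; first by rewrite enorm0.
  by move=> u a w b ua wb; apply: le_trans (enormD _ _) _; exact: lerD.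
by rewrite sumr_const card_ord mulr_natl.
Qed.

Lemma lipschitz_hess_average n (f : 'I_n -> 'rV[R]_d -> R) (L : R) :
  (0 < n)%N -> 0 <= L ->
  (forall i, lipschitz_hess L (f i)) -> lipschitz_hess L (average f).
Proof.
move=> n0 L0 fL.
have df i x : differentiable (f i) x by case: (fL i).
have dg i x : differentiable (grad (f i)) x by case: (fL i).
split=> [x|x|x y].
- by rewrite averageE; apply: differentiableZ; exact: differentiable_sum.
- by rewrite grad_average//; apply: differentiableZ; exact: differentiable_sum.
rewrite !hess_average// -scalerBr -sumrB.
apply: specnorm_le => [|v]; first by rewrite mulr_ge0// enorm_ge0.
rewrite -scalemxAr mulmx_sumr enormZ ger0_norm ?invr_ge0//.
rewrite mulrC ler_pdivrMr ?ltr0n// mulrC; apply: enorm_sum => i.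
apply: le_trans (enorm_mulmx_le _ _) _; rewrite ler_wpM2r ?enorm_ge0//.
by case: (fL i).
Qed.

End Average.

(** * One step of the method *)

(** One iteration, with the accuracies expressed through the radius: here eps is
    L r^2 and sqrt (eps L) is L r. *)
Record inexact_step (R : realType) (d : nat) (F : 'rV[R]_d -> R) (L r : R)
    (x g : 'rV[R]_d) (H : 'M[R]_d) (h : 'rV[R]_d) (lam : R) : Prop :=
  InexactStep {
  step_sym : H^T = H ;
  step_solution : tr_solution L r g H h lam ;
  step_grad_error : enorm (g - grad F x) <= L * r ^+ 2 / 6 ;
  step_hess_error : specnorm (H - hess F x) <= L * r / 3
}.

(** Up to the last term, the right-hand side is the tangent at v = r of the
    left-hand side viewed as a function of v^2.  The difference of the two sides
    is (r^2 + v^2) (r - v)^2 / (2 r). *)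
Lemma cubic_mean_le (R : realType) (r v w : R) : 0 < r -> v ^+ 2 = r ^+ 2 + w ->
  r ^+ 2 * v + r * v ^+ 2 + v ^+ 3 <= 3 * r ^+ 3 + 3 * r * w + w ^+ 2 / (2 * r).
Proof.
move=> r0 vw; have {vw}-> : w = v ^+ 2 - r ^+ 2 by rewrite vw addrC addKr.
rewrite -subr_ge0.
have -> : 3 * r ^+ 3 + 3 * r * (v ^+ 2 - r ^+ 2)
    + (v ^+ 2 - r ^+ 2) ^+ 2 / (2 * r) - (r ^+ 2 * v + r * v ^+ 2 + v ^+ 3) =
    (r ^+ 2 + v ^+ 2) * (r - v) ^+ 2 / (2 * r) by field; rewrite gt_eqF.
rewrite divr_ge0 ?(mulr_ge0 _ (ltW r0))//.
by rewrite mulr_ge0 ?sqr_ge0// addr_ge0 ?sqr_ge0.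
Qed.

Section Step.
Context {R : realType} {d : nat} (F : 'rV[R]_d -> R) (L r : R).
Hypotheses (L0 : 0 < L) (r0 : 0 < r) (FL : lipschitz_hess L F).
Implicit Types (x g h s v : 'rV[R]_d) (H : 'M[R]_d) (lam : R).

Lemma grad_error_dot x g H h lam v : inexact_step F L r x g H h lam ->
  `|dot g v - dot (grad F x) v| <= L * r ^+ 2 / 6 * enorm v.
Proof.
case=> _ _ gG _; rewrite -dotBl; apply: le_trans (cauchy_schwarz _ _) _.
by rewrite ler_wpM2r ?enorm_ge0.
Qed.

Lemma stationary_dot x g H h lam v : inexact_step F L r x g H h lam ->
  dot g v + dot (h *m H) v + L * lam / 2 * dot h v = 0.
Proof.
by case=> _ [_ _ _ st _ _] _ _; rewrite -dotZl -!dotDl st dot0l.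
Qed.

(** - g.h is the value at h of the quadratic form of H + (L lam / 2) I. *)
Lemma dot_grad_step_le0 x g H h lam : inexact_step F L r x g H h lam ->
  dot g h <= 0.
Proof.
move=> st; have := stationary_dot h st; have [_ [_ _ _ _ psd _] _ _] := st.
have := psd h; rewrite mulmx0 dot0l mulmxDr dotDl mul_mx_scalar dotZl; lra.
Qed.

(** F (x + h + s) is bounded above by the cubic expansion at x and below by the
    cubic expansion at x + h.  Comparing them bounds the linear term of the
    latter.  The quadratic terms in s cancel up to the errors on H and up to the
    variation of the Hessian between x and x + h, and the stationarity of h
    removes H from what remains.  For s = 0 this is the descent inequality. *)
Lemma next_grad_le x g H h lam s : inexact_step F L r x g H h lam ->
  dot (grad F (x + h)) s <=
    F x - F (x + h) + dot g h / 2 - L * lam / 4 * (enorm h ^+ 2 + 2 * dot h s)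
    + L / 6 * (r ^+ 2 * enorm (h + s) + r * enorm (h + s) ^+ 2
               + enorm (h + s) ^+ 3)
    + (L * r / 6 + L * enorm h / 2) * enorm s ^+ 2 + L / 6 * enorm s ^+ 3.
Proof.
move=> st; have [Hs _ _ HA] := st; have [_ _ hL] := FL.
have := taylor_lipschitz_hess (x + h) s FL; rewrite ler_norml => /andP[T1 _].
have := taylor_lipschitz_hess x (h + s) FL; rewrite ler_norml => /andP[_ T2].
have xhs : x + (h + s) = x + h + s := addrA x h s; rewrite {}xhs in T2.
have := grad_error_dot (h + s) st; rewrite ler_norml dotDr => /andP[B1 _].
have := quad_specnorm_le (h + s) HA.
rewrite ler_norml quad_sym// => /andP[B2 _].
have := quad_specnorm_le s HA; rewrite ler_norml => /andP[_ B3].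
have := quad_specnorm_le s (hL (x + h) x).
rewrite (addrC (x + h)) addKr ler_norml => /andP[B4 _].
have Sh := stationary_dot h st; have Ss := stationary_dot s st.
rewrite -sqr_enorm in Sh; clear - T1 T2 B1 B2 B3 B4 Sh Ss.
revert T1 T2 B1 B2 B3 B4 Sh Ss.
generalize (enorm h) (enorm s) (enorm (h + s)).
generalize (F x) (F (x + h)) (F (x + h + s)).
generalize (dot (grad F (x + h)) s) (dot (s *m hess F (x + h)) s).
generalize (dot (grad F x) (h + s)) (dot ((h + s) *m hess F x) (h + s)).
generalize (dot g h) (dot g s) (dot h s) (dot (s *m hess F x) s).
generalize (dot (h *m H) h) (dot (h *m H) s) (dot (s *m H) s).
move=> *; lra.
Qed.

Lemma long_step_norm g H h lam : tr_solution L r g H h lam ->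
  2 * r < lam -> enorm h = r.
Proof.
move=> [_ _ _ _ _ /eqP]; rewrite mulf_eq0 subr_eq0 => /orP[/eqP-> |/eqP//].
by rewrite ltNge mulr_ge0// ltW.
Qed.

(** The case s = 0 of [next_grad_le]: all that is left for a long step is the
    curvature term - g.h / 2. *)
Lemma long_step_decrease x g H h lam : inexact_step F L r x g H h lam ->
  2 * r < lam -> - dot g h / 2 <= F x - F (x + h).
Proof.
move=> st lamr; have hr := long_step_norm (step_solution st) lamr.
have := next_grad_le 0 st; rewrite addr0 !(dotC _ 0) !dot0l enorm0 hr.
have : 0 <= L * r ^+ 2 * (lam - 2 * r).
  by rewrite !mulr_ge0 ?exprn_ge0 ?ltW// subr_gt0.
generalize (dot g h) (F x) (F (x + h)) => a b c; lra.
Qed.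

(** Apart from the decrease and from g.h / 2 <= 0, the terms of [next_grad_le]
    that are of order 0 and 1 in s cancel for a step of length r when lam = 2 r,
    by the choice of the constants 1/6 and 1/3; a larger lam helps.  Here t
    measures s in units of r; the quadratic coefficients add up to
    1/2 + 27/64 + 2/3 + 1/24 < 2. *)
Lemma long_step_next_grad x g H h lam s (t : R) :
  inexact_step F L r x g H h lam -> 2 * r < lam ->
  0 <= t <= 1 / 4 -> enorm s = t * r ->
  dot (grad F (x + h)) s <= F x - F (x + h) + 2 * t ^+ 2 * (L * r ^+ 3).
Proof.
move=> st lamr /andP[t0 t4] sr.
have hr := long_step_norm (step_solution st) lamr.
have := next_grad_le s st; have gh := dot_grad_step_le0 st.
set v := enorm (h + s); set p := dot h s; rewrite hr sr.
have v2 : v ^+ 2 = r ^+ 2 + 2 * p + t ^+ 2 * r ^+ 2.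
  rewrite sqr_enorm dotDl !dotDr -!sqr_enorm hr sr (dotC s) -/p; ring.
have : `|p| <= r * (t * r) by have := cauchy_schwarz h s; rewrite hr sr.
rewrite ler_norml => /andP[p1 p2].
(* w = |h + s|^2 - r^2 *)
pose w := 2 * p + t ^+ 2 * r ^+ 2.
have rr : 0 < r ^+ 2 by rewrite exprn_gt0.
have tr0 : 0 <= t * r ^+ 2 by rewrite mulr_ge0 ?(ltW rr).
have tr1 : 0 <= (1 / 4 - t) * (t * r ^+ 2) by rewrite mulr_ge0// subr_ge0.
have tr2 : 0 <= (1 / 4 - t) * r ^+ 2 by rewrite mulr_ge0 ?subr_ge0 ?(ltW rr).
have tr3 : 0 <= t ^+ 2 * r ^+ 2 by rewrite mulr_ge0 ?sqr_ge0.
have w2 : w ^+ 2 / (2 * r) <= 81 / 32 * t ^+ 2 * r ^+ 3.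
  rewrite ler_pdivrMr ?mulr_gt0//.
  have : 0 <= (9 / 4 * (t * r ^+ 2) - w) * (9 / 4 * (t * r ^+ 2) + w).
    by rewrite mulr_ge0// /w; lra.
  by lra.
have vw : v ^+ 2 = r ^+ 2 + w by rewrite v2 /w addrA.
have M := cubic_mean_le r0 vw.
have M1 : 0 <= L * (3 * r ^+ 3 + 3 * r * w + 81 / 32 * t ^+ 2 * r ^+ 3
                    - (r ^+ 2 * v + r * v ^+ 2 + v ^+ 3)).
  by rewrite mulr_ge0 ?(ltW L0)//; lra.
have M2 : 0 <= L * ((lam - 2 * r) * (r ^+ 2 + 2 * p)).
  by rewrite !mulr_ge0 ?(ltW L0) ?subr_ge0 ?(ltW lamr)//; lra.
have M3 : 0 <= L * (r ^+ 3 * (t ^+ 2 * (1 / 4 - t))).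
  by rewrite !mulr_ge0 ?exprn_ge0 ?subr_ge0 ?(ltW L0) ?(ltW r0).
have M4 : 0 <= L * (r ^+ 3 * t ^+ 2).
  by rewrite !mulr_ge0 ?exprn_ge0 ?(ltW L0) ?(ltW r0).
rewrite /w in M1; move: gh; clear - M1 M2 M3 M4.
generalize (dot (grad F (x + h)) s) (F x) (F (x + h)) (dot g h).
by move=> *; lra.
Qed.

(** The term - g.h enters the lower bound of [long_step_decrease] with
    coefficient 1/2.  It enters the one given by Taylor at x with coefficient
    - 1/2, since hHh = - g.h - (L lam / 2) r^2.  It disappears from the sum. *)
Lemma decrease_vs_grad x g H h lam : inexact_step F L r x g H h lam ->
  2 * r < lam ->
  L * r ^+ 3 / 6 - dot (grad F x) h <= 2 * (F x - F (x + h)).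
Proof.
move=> st lamr; have hr := long_step_norm (step_solution st) lamr.
have := long_step_decrease st lamr.
have := taylor_lipschitz_hess x h FL; rewrite ler_norml => /andP[_ T].
have := quad_specnorm_le h (step_hess_error st).
rewrite ler_norml => /andP[B _].
have := stationary_dot h st; rewrite -sqr_enorm.
have : 0 <= L * r ^+ 2 * (lam - 2 * r).
  by rewrite !mulr_ge0 ?exprn_ge0 ?ltW// subr_gt0.
move: T B; rewrite hr.
generalize (dot g h) (F x) (F (x + h)) (dot (grad F x) h).
generalize (dot (h *m hess F x) h) (dot (h *m H) h).
by move=> *; lra.
Qed.

Lemma two_long_steps_decrease x g H h lam g' H' h' lam' :
  inexact_step F L r x g H h lam -> 2 * r < lam ->
  inexact_step F L r (x + h) g' H' h' lam' -> 2 * r < lam' ->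
  L * r ^+ 3 / 300 <= F x - F (x + h + h').
Proof.
move=> st lamr st' lamr'; have hr' := long_step_norm (step_solution st') lamr'.
(* with t = 1/20, 2 t^2 / t = 1/10 is below the 1/6 of [decrease_vs_grad] *)
have t20 : 0 <= (20^-1 : R) <= 1 / 4 by apply/andP; split; lra.
have sr : enorm (20^-1 *: h') = 20^-1 * r by rewrite enormZ hr' ger0_norm.
have := long_step_next_grad st lamr t20 sr; rewrite dotZr.
have := decrease_vs_grad st' lamr'.
have := long_step_decrease st' lamr'; have := dot_grad_step_le0 st'.
have := long_step_decrease st lamr; have := dot_grad_step_le0 st.
generalize (dot g h) (dot g' h') (dot (grad F (x + h)) h').
generalize (F x) (F (x + h)) (F (x + h + h')).
by move=> *; lra.
Qed.

(** Apply [next_grad_le] to s of length r in the direction of the gradient, with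
    the decrease bounded above by Taylor at x.  Every term is then a multiple of
    L r^3, and the coefficients add up to 14/3 < 5. *)
Lemma short_step_grad x g H h lam : inexact_step F L r x g H h lam ->
  lam <= 2 * r -> enorm (grad F (x + h)) <= 5 * (L * r ^+ 2).
Proof.
move=> st lamr; have [hr _ lam0 _ _ _] := step_solution st.
have [->|G0] := eqVneq (enorm (grad F (x + h))) 0.
  by rewrite !mulr_ge0 ?exprn_ge0 ?(ltW L0) ?(ltW r0).
have {}G0 : 0 < enorm (grad F (x + h)) by rewrite lt_def G0 enorm_ge0.
pose s := (r / enorm (grad F (x + h))) *: grad F (x + h).
have sr : enorm s = r.
  by rewrite enormZ ger0_norm ?divr_ge0 ?(ltW r0) ?(ltW G0)// divfK// gt_eqF.
have sG : dot (grad F (x + h)) s = enorm (grad F (x + h)) * r.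
  by rewrite dotZr -sqr_enorm; field; rewrite gt_eqF.
rewrite -(ler_pM2r r0) -sG.
have h0 := enorm_ge0 h; have v0 := enorm_ge0 (h + s).
have v2 : enorm (h + s) <= 2 * r by have := enormD h s; rewrite sr; lra.
have := next_grad_le s st; rewrite sr.
have := taylor_lipschitz_hess x h FL; rewrite ler_norml => /andP[T _].
have := grad_error_dot h st; rewrite ler_norml => /andP[_ B1].
have := quad_specnorm_le h (step_hess_error st).
rewrite ler_norml => /andP[_ B2].
have := stationary_dot h st; rewrite -sqr_enorm.
have := cauchy_schwarz h s; rewrite sr ler_norml => /andP[p _].
move: T B1 B2 p h0 v0 v2 hr; clear - L0 r0 lam0 lamr.
generalize (enorm h) (enorm (h + s)) (F x) (F (x + h)) => a v f0 f1.
generalize (dot (grad F (x + h)) s) (dot (grad F x) h) (dot g h) (dot h s).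
generalize (dot (h *m hess F x) h) (dot (h *m H) h).
move=> qA qH G' G gh p T B1 B2 pa a0 v0 v2 ar S N.
have Lge0 := ltW L0; have rge0 := ltW r0.
have sq b c : 0 <= b -> b <= c -> b ^+ 2 <= c ^+ 2 :> R.
  by move=> b0 bc; rewrite lerXn2r ?nnegrE// (le_trans b0).
have cb b c : 0 <= b -> b <= c -> b ^+ 3 <= c ^+ 3 :> R.
  by move=> b0 bc; rewrite lerXn2r ?nnegrE// (le_trans b0).
have P b c : b <= c -> 0 <= L * (c - b).
  by move=> bc; rewrite mulr_ge0 ?subr_ge0.
have Pr b c : b <= c -> 0 <= L * (r * (c - b)).
  by move=> bc; rewrite !mulr_ge0 ?subr_ge0.
have Prr b c : b <= c -> 0 <= L * (r ^+ 2 * (c - b)).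
  by move=> bc; rewrite !mulr_ge0 ?exprn_ge0 ?subr_ge0.
have := P _ _ (cb _ _ a0 ar); have := Pr _ _ (sq _ _ a0 ar); have := Prr _ _ ar.
have := P _ _ (cb _ _ v0 v2); have := Pr _ _ (sq _ _ v0 v2); have := Prr _ _ v2.
have := Prr _ _ lamr; have := Prr _ _ rge0.
have : 0 <= L * (lam * (p + a * r)) by rewrite !mulr_ge0//; lra.
have : 0 <= L * (lam * r * (r - a)) by rewrite !mulr_ge0// subr_ge0.
clear - N S T B1 B2 L0 r0; lra.
Qed.

(** The dual certificate bounds H below by - L lam / 2 >= - L r; the error on H
    costs L r / 3 and the move from x to x + h at most L r. *)
Lemma short_step_hess x g H h lam : inexact_step F L r x g H h lam ->
  lam <= 2 * r -> loewner_le (- (7 / 3 * (L * r)))%:M (hess F (x + h)).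
Proof.
move=> st lamr v; have [hr _ lam0 _ psd _] := step_solution st.
have [_ _ hL] := FL.
have := quad_specnorm_le v (hL (x + h) x).
rewrite (addrC (x + h)) addKr ler_norml => /andP[B1 _].
have := quad_specnorm_le v (step_hess_error st).
rewrite ler_norml => /andP[_ B2].
have := psd v.
rewrite mulmx0 dot0l mulmxDr dotDl !mul_mx_scalar !dotZl -sqr_enorm.
have : 0 <= L * (2 * r - lam) * enorm v ^+ 2.
  by rewrite !mulr_ge0 ?enorm_ge0 ?subr_ge0 ?(ltW L0).
have : 0 <= L * (r - enorm h) * enorm v ^+ 2.
  by rewrite !mulr_ge0 ?enorm_ge0 ?subr_ge0 ?(ltW L0).
move: B1 B2; clear; generalize (enorm v) (enorm h).
generalize (dot (v *m H) v) (dot (v *m hess F x) v).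
generalize (dot (v *m hess F (x + h)) v).
by move=> *; lra.
Qed.

End Step.

(** * Runs of the method *)

Section Run.
Context {R : realType} {d : nat} (F : 'rV[R]_d -> R).
Context (L eps : R) (x0 : 'rV[R]_d).
Context (x g : nat -> 'rV[R]_d) (H : nat -> 'M[R]_d) (h : nat -> 'rV[R]_d).
Context (lam : nat -> R).
Hypotheses (L0 : 0 < L) (eps0 : 0 < eps) (FL : lipschitz_hess L F).
Local Notation r := (Num.sqrt (eps / L)).
Hypothesis run : tr_run L eps r x0 x g H h lam.
Hypothesis errors : forall k, tr_executed L eps lam k ->
  enorm (g k - grad F (x k)) <= eps / 6 /\
  specnorm (H k - hess F (x k)) <= Num.sqrt (eps * L) / 3.

Lemma radius_gt0 : 0 < r.
Proof. by rewrite sqrtr_gt0 divr_gt0. Qed.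

Lemma mul_sqr_radius : L * r ^+ 2 = eps.
Proof. by rewrite sqr_sqrtr ?divr_ge0 ?ltW// mulrC divfK// gt_eqF. Qed.

Lemma mul_radius : L * r = Num.sqrt (eps * L).
Proof.
have Lr : 0 <= L * r by rewrite mulr_ge0 ?sqrtr_ge0// ltW.
rewrite -[LHS](ger0_norm Lr) -sqrtr_sqr exprMn sqr_sqrtr ?divr_ge0 ?ltW//.
by congr Num.sqrt; field; rewrite gt_eqF.
Qed.

Lemma executed_le k m : (m <= k)%N ->
  tr_executed L eps lam k -> tr_executed L eps lam m.
Proof. by move=> mk ex j jm; apply: ex; exact: leq_trans jm mk. Qed.

Lemma executed_step k : tr_executed L eps lam k ->
  inexact_step F L r (x k) (g k) (H k) (h k) (lam k).
Proof.
move=> ex; have [eg eH] := errors ex; split.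
- exact: (run_sym run).
- exact: (run_solution run).
- by rewrite mul_sqr_radius.
- by rewrite mul_radius.
Qed.

(** The steps 0, ..., 2m - 1 preceding iteration 2m are long and are grouped in
    m consecutive pairs. *)
Lemma executed_decrease m : tr_executed L eps lam m.*2 ->
  m%:R * (L * r ^+ 3 / 300) <= F x0 - F (x m.*2).
Proof.
elim: m => [_|m IH ex]; first by rewrite double0 (run_init run) subrr mul0r.
have ex0 : tr_executed L eps lam m.*2.
  by apply: executed_le ex; rewrite doubleS -addn2 leq_addr.
have ex1 : tr_executed L eps lam m.*2.+1.
  by apply: executed_le ex; rewrite doubleS.
have long j : (j < m.+1.*2)%N -> 2 * r < lam j.
  by move=> /ex /negP; rewrite /tr_stop -ltNge.
have st1 := executed_step ex1; rewrite (run_update run ex0) in st1.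
have := two_long_steps_decrease L0 radius_gt0 FL (executed_step ex0)
  (long _ _) st1 (long _ _).
rewrite doubleS -(run_update run ex0) -(run_update run ex1).
move=> /(_ (ltnW (ltnSn _)) (ltnSn _)) D.
rewrite -natr1 mulrDl mul1r; apply: le_trans (lerD (IH ex0) D) _; lra.
Qed.

(** Without a stop the decrease would exceed B.  If the first stop occurs at k,
    then iteration 2 (k / 2) is executed, and k + 1 <= 2 (k / 2) + 2. *)
Lemma exists_stop (B : R) : (forall y, F x0 - F y <= B) ->
  exists k, [/\ tr_executed L eps lam k, tr_stop L eps lam k &
    k.+1%:R <= 2 + 600 * (B / (L * r ^+ 3))].
Proof.
move=> FB; set c := L * r ^+ 3.
have c0 : 0 < c by rewrite mulr_gt0 ?exprn_gt0 ?radius_gt0.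
have B0 : 0 <= B by have := FB x0; rewrite subrr.
have dec m : tr_executed L eps lam m.*2 -> m%:R * (c / 300) <= B.
  by move=> /executed_decrease /le_trans; apply.
clearbody c.
have mB m : tr_executed L eps lam m.*2 -> m%:R <= 300 * (B / c).
  move=> /dec; rewrite -ler_pdivlMr ?divr_gt0//.
  by have -> : B / (c / 300) = 300 * (B / c) by field; rewrite gt_eqF.
have [k0 stop0] : exists k, lam k <= 2 * r.
  apply: contrapT => /forallNP nostop.
  pose m := Num.bound (300 * (B / c)).
  have /mB : tr_executed L eps lam m.*2 by move=> j _; exact: nostop.
  have Bc : 0 <= 300 * (B / c) by rewrite mulr_ge0// divr_ge0// ltW.
  by have := archi_boundP Bc; rewrite ltNge => /negP.
case: (ex_minnP (ex_intro (fun k => lam k <= 2 * r) k0 stop0)) => k stopk mink.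
have exk : tr_executed L eps lam k.
  by move=> j jk /mink; rewrite leqNgt jk.
exists k; split=> //.
have /mB : tr_executed L eps lam k./2.*2.
  by apply: executed_le exk; rewrite -[leqRHS]odd_double_half leq_addl.
have : k.+1%:R <= 2 + 2 * k./2%:R :> R.
  rewrite -natrM -natrD ler_nat -{1}[k]odd_double_half -mul2n.
  by case: (odd k).
lra.
Qed.

End Run.

Lemma iteration_scale (R : realType) (L eps Delta : R) : 0 < L -> 0 < eps ->
  Num.sqrt L * Delta / eps `^ (3 / 2) = Delta / (L * Num.sqrt (eps / L) ^+ 3).
Proof.
move=> L0 eps0; have e32 : eps `^ (3 / 2) = Num.sqrt eps ^+ 3.
  by rewrite mulrC powRrM powR12_sqrt ?ltW// powR_mulrn// sqrtr_ge0.
have sL : 0 < Num.sqrt L by rewrite sqrtr_gt0.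
have se : 0 < Num.sqrt eps by rewrite sqrtr_gt0.
rewrite e32 sqrtrM ?ltW// sqrtrV ?ltW// -[in RHS](sqr_sqrtr (ltW L0)).
rewrite sqrtr_sqr ger0_norm ?ltW//.
by field; rewrite !gt_eqF.
Qed.

Theorem theorem3p1 (R : realType) :
  exists C : R, 0 < C /\
  forall (d n : nat) (f : 'I_n -> 'rV[R]_d -> R) (L1 L2 eps : R)
    (x0 xstar : 'rV[R]_d) (x g : nat -> 'rV[R]_d) (H : nat -> 'M[R]_d)
    (h : nat -> 'rV[R]_d) (lam : nat -> R),
  let F := average f in
  let Delta := F x0 - F xstar in
  (0 < n)%N -> 0 < L2 -> 0 < eps ->
  (forall y, F xstar <= F y) ->
  (forall i, lipschitz_grad L1 (f i)) ->
  (forall i, lipschitz_hess L2 (f i)) ->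
  tr_run L2 eps (Num.sqrt (eps / L2)) x0 x g H h lam ->
  (forall k, tr_executed L2 eps lam k ->
     enorm (g k - grad F (x k)) <= eps / 6 /\
     specnorm (H k - hess F (x k)) <= Num.sqrt (eps * L2) / 3) ->
  exists k : nat,
    [/\ tr_executed L2 eps lam k,
        tr_stop L2 eps lam k,
        k.+1%:R < C * Num.max 1 (Num.sqrt L2 * Delta / eps `^ (3 / 2)) &
        approx_sosp F (C * eps) (C * Num.sqrt (L2 * eps)) (x k.+1)].
Proof.
(* 603 > 600 + 2, for the strict inequality; it also covers 5 and 7/3 *)
exists 603; split; first by rewrite ltr0n.
move=> d n f L1 L2 eps x0 xstar x g H h lam F Delta n0 L0 eps0.
move=> Fmin _ fL run errors.
have FL : lipschitz_hess L2 F by exact: lipschitz_hess_average (ltW L0) fL.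
have FD y : F x0 - F y <= Delta by rewrite lerB.
have [k [exk stopk kB]] := exists_stop L0 eps0 FL run errors FD.
have st := executed_step L0 eps0 run errors exk.
have r0 := radius_gt0 L0 eps0.
exists k; split=> //.
  rewrite iteration_scale//; move: kB; set q := Delta / _ => kB.
  have : 1 <= Num.max 1 q by rewrite le_max lexx.
  have : q <= Num.max 1 q by rewrite le_max lexx orbT.
  lra.
rewrite (run_update run exk); split.
  have := short_step_grad L0 r0 FL st stopk; rewrite mul_sqr_radius//; lra.
move=> v; apply: le_trans (short_step_hess L0 FL st stopk v).
rewrite !mul_mx_scalar !dotZl mul_radius// (mulrC L2).
rewrite ler_wpM2r ?dot_ge0// lerN2 ler_wpM2r ?sqrtr_ge0//; lra.
Qed.
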